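(* Let $A,B\in\mathcal{L}(\mathcal{H})$ have closed ranges and satisfy $\mathcal{R}((B-A)^\dagger)=\mathcal{R}(B^\dagger-A^\dagger)$ and $\mathcal{R}((B^*-A^* )^\dagger)=\mathcal{R}((B^* )^\dagger-(A^* )^\dagger)$. Then $A\overset{\diamond}{\leq}B$ if and only if $A^\dagger\overset{\diamond}{\leq}B^\dagger$.
   Context: $\mathcal{H}$ is a complex Hilbert space, $\mathcal{L}(\mathcal{H})$ is the algebra of bounded linear operators on $\mathcal{H}$, and $\mathcal{R}(T)$, $\mathcal{N}(T)$ denote range and nullspace. The Moore-Penrose inverse of $T\in\mathcal{L}(\mathcal{H})$ is the (in general densely defined, unbounded) operator $T^\dagger:\mathcal{R}(T)\oplus\mathcal{R}(T)^\perp\to\mathcal{H}$ with $T^\dagger|_{\mathcal{R}(T)}=(T|_{\mathcal{N}(T)^\perp})^{-1}$ (where $T|_{\mathcal{N}(T)^\perp}:\mathcal{N}(T)^\perp\to\mathcal{R}(T)$) and $\mathcal{N}(T^\dagger)=\mathcal{R}(T)^\perp$; $T^\dagger\in\mathcal{L}(\mathcal{H})$ if and only if $\mathcal{R}(T)$ is closed. Diamond order: for $A,B\in\mathcal{L}(\mathcal{H})$, $A\overset{\diamond}{\leq}B$ if $\mathcal{R}(A)\subseteq\mathcal{R}(B)$, $\mathcal{R}(A^* )\subseteq\mathcal{R}(B^* )$ and $AA^*A=AB^*A$. *)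

(* Defs.v *)
From HB Require Import structures.
From mathcomp Require Import all_boot all_order all_algebra.
From mathcomp Require Import all_classical all_reals all_analysis.
From mathcomp Require Export complex.

Set Implicit Arguments.
Unset Strict Implicit.
Unset Printing Implicit Defensive.

Import Order.TTheory GRing.Theory Num.Theory.
Import numFieldNormedType.Exports.

Local Open Scope classical_set_scope.
Local Open Scope ring_scope.
Local Open Scope complex_scope.

(* The inner product is linear in its first argument and conjugate-linear in
   its second one. *)
HB.mixin Record isHilbert (R : realType) (H : Type)
    of CompleteNormedModule R[i] H := {
  dotp : {dot H for @Num.conj R[i]} ;
  dotp_norm : forall x : H, `|x| ^+ 2 = dotp x x
}.

#[short(type="hilbertType")]
HB.structure Definition Hilbert (R : realType) :=
  {H of isHilbert R H & CompleteNormedModule R[i] H}.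

Section Operators.
Context {R : realType} {H : hilbertType R}.
Implicit Types (S : set H) (T A B : H -> H).

Definition orthocomp S : set H := [set x | forall y, S y -> dotp x y = 0].

Definition nullspace T : set H := T @^-1` [set 0].

(* For T in L(H) the vector adjoint T y exists (Riesz) and is unique; the
   default value 0 is never used. *)
Definition adjoint T : H -> H := fun y =>
  xget 0 [set z | forall x, dotp (T x) y = dotp x z].

(* Inverse of the bijection nullspace T ^perp -> range T induced by a linear
   T, extended by 0 outside range T. *)
Definition restr_inv T : H -> H := fun u =>
  xget 0 [set x | orthocomp (nullspace T) x /\ T x = u].

(* The domain of the Moore-Penrose inverse: range T (+) (range T)^perp. *)
Definition mpinv_dom T : set H :=
  [set y | exists2 u, range T u & orthocomp (range T) (y - u)].

(* mpinv T y applies restr_inv T to the component of y in range T. It is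
   meaningful on mpinv_dom T only (junk value 0 elsewhere); this is the whole
   space when range T is closed. *)
Definition mpinv T : H -> H := fun y =>
  restr_inv T (xget 0 [set u | range T u /\ orthocomp (range T) (y - u)]).

Definition mpinv_range T : set H := mpinv T @` mpinv_dom T.

Definition diamond_le A B : Prop :=
  [/\ range A `<=` range B,
      range (adjoint A) `<=` range (adjoint B) &
      A \o adjoint A \o A =1 A \o adjoint B \o A].

End Operators.

(* Main.v *)
Require Import Defs.
From mathcomp Require Import all_boot all_order all_algebra.
From mathcomp Require Import all_classical all_reals all_analysis.
From mathcomp Require Import ring lra zify.

(** Write C, D for the Moore-Penrose inverses of A, B.  Everything that the
    proof uses of C is collected in the record [penrose]: A and C have
    adjoints, ACA = A, CAC = C, and AC, CA are self-adjoint.  This list is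
    symmetric in A and C, so each fact about it yields a dual one by exchanging
    an operator with its Moore-Penrose inverse.

    The first step ([diamond_penrose]) rewrites the diamond order.  Since
    R(A* ) = R(C), the two range conditions read R(A) <= R(B) and
    R(C) <= R(D); compressing AA*A = AB*A by C on both sides turns it into
    CBC = C.  Dually, the diamond order between C and D amounts to the same two
    range conditions together with ADA = A.  So the theorem says that, under
    the range conditions, CBC = C if and only if ADA = A
    ([inner_inverse_transfer]).

    Put E = B - A and F = D - C.  As the range of the Moore-Penrose inverse of
    E is N(E)^perp ([mpinv_rangeE]), the hypothesis says N(E)^perp = R(F).

    If ADA = A, then E(DA) = 0, so a vector A*w in N(E)^perp satisfies
    0 = <DAx, A*w> = <ADAx, w> = <x, A*w> for all x: thus R(C) and R(F) meet
    only in 0.  With u = BCx one has Du = Cx, so Fu = Cx - Cu lies in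
    both, and Cx = Cu = CBCx.

    If CBC = C, then CBF = 0 while CB is the identity on R(C), so again
    R(C) and R(F) meet only in 0.  With u = D*A*w one has B*u = A*w, so
    E*u = A*(w - u) lies in R(C) and in R(E* ) <= N(E)^perp = R(F).
    Hence A*w = A*u = A*D*A*w, the adjoint of ADA = A.

    The analytic work is to show that C satisfies [penrose]
    ([mpinv_penrose]), the main point being that C is bounded and so has an
    adjoint ([mpinv_bounded]).  By the uniform boundedness principle the
    w in R(A) with |A*w| <= 1 form a bounded set: against a fixed u they are
    controlled by <u, w> = <ACu, w> = <Cu, A*w>.  Since Cu lies in N(A)^perp,
    it is approximated by vectors A*w with w in R(A), and estimating
    <Cu, Cu> through <Cu, A*w> = <u, w> bounds |Cu| by a multiple of |u|. *)

Set Implicit Arguments.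
Unset Strict Implicit.
Unset Printing Implicit Defensive.

Import Order.TTheory GRing.Theory Num.Theory.
Import numFieldNormedType.Exports.

Local Open Scope classical_set_scope.
Local Open Scope ring_scope.

Section Hilbert_operators.
Context {R : realType} {H : hilbertType R}.
Implicit Types x y z p : H.
Implicit Types S : set H.
Implicit Types T A B C D : H -> H.

(** * Inner product *)

Lemma dotpC x y : dotp y x = Num.conj (dotp x y).
Proof. by rewrite hermC expr0 mul1r. Qed.

Lemma dotpDl x y z : dotp (x + y) z = dotp x z + dotp y z.
Proof. by rewrite linearDl. Qed.

Lemma dotpDr x y z : dotp x (y + z) = dotp x y + dotp x z.
Proof. by rewrite linearD. Qed.

Lemma dotpBl x y z : dotp (x - y) z = dotp x z - dotp y z.
Proof. by rewrite linearBl. Qed.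

Lemma dotpBr x y z : dotp x (y - z) = dotp x y - dotp x z.
Proof. by rewrite linearB. Qed.

Lemma dotp0l x : dotp 0 x = 0.
Proof. by rewrite linear0l. Qed.

Lemma dotp0r x : dotp x 0 = 0.
Proof. by rewrite linear0. Qed.

Lemma dotpZl a x y : dotp (a *: x) y = a * dotp x y.
Proof. by rewrite linearZl_LR. Qed.

Lemma dotpZr a x y : dotp x (a *: y) = Num.conj a * dotp x y.
Proof. by rewrite linearZr_LR. Qed.

Lemma dotp_eq0 x : dotp x x = 0 -> x = 0.
Proof. by move/eqP; rewrite -dotp_norm expf_eq0 normr_eq0 => /= /eqP. Qed.

Lemma dotp_sub x y :
  dotp (x - y) (x - y) =
  dotp x x + dotp y y - (dotp x y + Num.conj (dotp x y)).
Proof. by rewrite dotpBl !dotpBr (dotpC x y); ring. Qed.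

Lemma dotp_injr y z : (forall x, dotp x y = dotp x z) -> y = z.
Proof.
move=> yz; apply/eqP; rewrite -subr_eq0; apply/eqP/dotp_eq0.
by rewrite dotpBr yz subrr.
Qed.

Lemma dotp_injl y z : (forall x, dotp y x = dotp z x) -> y = z.
Proof. by move=> yz; apply: dotp_injr => x; rewrite dotpC yz -dotpC. Qed.

Lemma dotp_sym0 x y : dotp x y = 0 -> dotp y x = 0.
Proof. by move=> xy; rewrite dotpC xy conjC0. Qed.

(** * Real-valued norm *)

(** The norm of a normed R[i]-module takes values in R[i], where the order is
    partial; its real part allows infima and linear arithmetic over R. *)
Definition rnorm {V : normedZmodType R[i]} (v : V) : R := complex.Re `|v|.

Lemma rnormE (V : normedZmodType R[i]) (v : V) : (rnorm v)%:C%C = `|v|.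
Proof. by rewrite /rnorm RRe_real// normr_real. Qed.

Lemma rnorm_ge0 (V : normedZmodType R[i]) (v : V) : 0 <= rnorm v.
Proof. by rewrite -ler0c rnormE. Qed.

Lemma rnorm_eq0 (V : normedZmodType R[i]) (v : V) : (rnorm v == 0) = (v == 0).
Proof. by rewrite -(inj_eq (@complexI _)) rnormE normr_eq0. Qed.

Lemma rnorm0 (V : normedZmodType R[i]) : rnorm (0 : V) = 0.
Proof. by rewrite /rnorm normr0. Qed.

Lemma rnorm_gt0 (V : normedZmodType R[i]) (v : V) : (0 < rnorm v) = (v != 0).
Proof. by rewrite lt_def rnorm_eq0 rnorm_ge0 andbT. Qed.

Lemma rnormD (V : normedZmodType R[i]) (v w : V) :
  rnorm (v + w) <= rnorm v + rnorm w.
Proof. by rewrite -lecR rmorphD/= !rnormE ler_normD. Qed.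

Lemma rnormN (V : normedZmodType R[i]) (v : V) : rnorm (- v) = rnorm v.
Proof. by rewrite /rnorm normrN. Qed.

Lemma rnorm_distC (V : normedZmodType R[i]) (v w : V) :
  rnorm (v - w) = rnorm (w - v).
Proof. by rewrite -rnormN opprB. Qed.

Lemma rnormM (a b : R[i]) : rnorm (a * b) = rnorm a * rnorm b.
Proof. by apply: complexI; rewrite rmorphM/= !rnormE normrM. Qed.

Lemma rnormZ (a : R[i]) x : rnorm (a *: x) = rnorm a * rnorm x.
Proof. by apply: complexI; rewrite rmorphM/= !rnormE normrZ. Qed.

Lemma rnorm_real (r : R) : 0 <= r -> rnorm (r%:C)%C = r.
Proof. by move=> r0; apply: complexI; rewrite rnormE ger0_norm// ler0c. Qed.

Lemma rnorm2 : rnorm (2 : R[i]) = 2.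
Proof. by rewrite -(rnorm_real (ler0n R 2)) rmorph_nat. Qed.

Lemma rnorm_le_small_eq0 (V : normedZmodType R[i]) (v : V) (c : R) :
  (forall e : R, 0 < e -> rnorm v <= e * c) -> v = 0.
Proof.
move=> vc; apply/eqP; rewrite -rnorm_eq0 eq_le rnorm_ge0 andbT leNgt.
apply/negP => v0; have c0 : 0 < c by have := vc 1 ltr01; lra.
have e0 : 0 < rnorm v / (c * 2) by rewrite divr_gt0// mulr_gt0.
have := vc _ e0; rewrite invfM mulrA mulrAC divfK ?gt_eqF//; lra.
Qed.

Lemma rnorm_sqr x : (rnorm x ^+ 2)%:C%C = dotp x x.
Proof. by rewrite rmorphXn/= rnormE dotp_norm. Qed.

(** Removing from x its component along y: this identity gives the
    Cauchy-Schwarz inequality, and shows that almost-minimizers of a distance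
    to a subspace are almost orthogonal to it. *)
Lemma rnorm_sub_component x y : y != 0 ->
  rnorm (x - (dotp x y / dotp y y) *: y) ^+ 2 =
  rnorm x ^+ 2 - rnorm (dotp x y) ^+ 2 / rnorm y ^+ 2.
Proof.
move=> y0; apply: complexI; rewrite rmorphB/= fmorph_div/= !rnorm_sqr.
rewrite [in RHS]rmorphXn/= rnormE normCK dotp_sub !dotpZl !dotpZr.
have : dotp y y != 0 by apply: contra_neq y0 => /dotp_eq0.
rewrite !rmorphM/= !fmorphV/= conjCK -!(dotpC y y) => yy0.
by field.
Qed.

Lemma Cauchy_Schwarz x y : rnorm (dotp x y) <= rnorm x * rnorm y.
Proof.
have [->|y0] := eqVneq y 0.
  by rewrite dotp0r rnorm0 mulr_ge0// rnorm_ge0.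
have yp : 0 < rnorm y by rewrite rnorm_gt0.
rewrite -ler_sqr ?nnegrE ?mulr_ge0 ?rnorm_ge0// exprMn.
rewrite -ler_pdivrMr ?exprn_gt0//.
by rewrite -subr_ge0 -(rnorm_sub_component _ y0) sqr_ge0.
Qed.

Lemma parallelogram x y :
  rnorm (x + y) ^+ 2 + rnorm (x - y) ^+ 2 = 2 * (rnorm x ^+ 2 + rnorm y ^+ 2).
Proof.
apply: complexI; rewrite rmorphM/= !rmorphD/= !rnorm_sqr rmorph1.
by rewrite !dotpBl !dotpBr !dotpDl !dotpDr; ring.
Qed.

(** * Completeness, closedness and boundedness *)

Lemma gtc0_Re (e : R[i]) : 0 < e -> 0 < complex.Re e.
Proof. by rewrite ltcE => /andP[]. Qed.

Lemma ltc_half_Re (e : R[i]) : 0 < e -> (complex.Re e / 2)%:C%C < e.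
Proof.
move=> e0; have := gtc0_Re e0; move: e0.
by rewrite !ltcE /= => /andP[-> _]; lra.
Qed.

Lemma invS_le_eventually (e : R) : 0 < e ->
  exists n, forall i, (n <= i)%N -> i.+1%:R^-1 <= e.
Proof.
move=> e0; exists (Num.truncn e^-1) => i ni.
rewrite -[e]invrK lef_pV2 ?posrE ?invr_gt0//.
by rewrite (le_trans (ltW (truncnS_gt _)))// ler_nat.
Qed.

Definition adherent (S : set H) (p : H) :=
  forall e : R, 0 < e -> exists2 s, S s & rnorm (p - s) <= e.

Lemma closed_adherent S p : closed S -> adherent S p -> S p.
Proof.
move=> cS ap; apply: cS => U /nbhs_normP[e /= e0 eU].
have [|s Ss ps] := ap (complex.Re e / 2); first by rewrite divr_gt0 ?gtc0_Re.
exists s; split=> //; apply: eU => /=.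
by rewrite -rnormE; apply: le_lt_trans (ltc_half_Re e0); rewrite lecR.
Qed.

Lemma cauchy_seq_lim (u : nat -> H) :
  (forall e : R, 0 < e -> exists n, forall i j,
     (n <= i)%N -> (n <= j)%N -> rnorm (u i - u j) <= e) ->
  exists l, forall e : R, 0 < e -> exists n, forall i,
     (n <= i)%N -> rnorm (l - u i) <= e.
Proof.
move=> cu; have cvu : cvg (u @ \oo).
  apply: cauchy_cvg; apply: cauchy_exP => e e0.
  have [|n nu] := cu (complex.Re e / 2); first by rewrite divr_gt0 ?gtc0_Re.
  exists (u n), n => // m /= nm; rewrite -ball_normE /=.
  by rewrite -rnormE; apply: le_lt_trans (ltc_half_Re e0); rewrite lecR nu.
exists (lim (u @ \oo)) => e e0.
have e0C : 0 < e%:C%C by rewrite ltcR.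
have [n _ nu] := (cvgrPdist_le _ _).1 cvu _ e0C.
by exists n => i /nu; rewrite /= -lecR rnormE.
Qed.

Lemma bounded_near_rnorm (A : {linear H -> H}) :
  bounded_near A (nbhs (0 : H)) ->
  exists M : R, forall x, rnorm (A x) <= M * rnorm x.
Proof.
move=> /linear_boundedP/pinfty_ex_gt0[M M0 MA].
exists (complex.Re M) => x; rewrite -lecR rmorphM/= !rnormE RRe_real ?MA//.
exact: gtr0_real.
Qed.

(** A bounded additive map vanishes at p because its value at p equals its
    value at p - s for every s in the kernel, and p - s can be made small. *)
Lemma bounded_kernel_adherent (V : normedZmodType R[i]) (f : H -> V) (M : R) p :
  {morph f : x y / x - y} -> (forall x, rnorm (f x) <= M * rnorm x) ->
  adherent [set x | f x = 0] p -> f p = 0.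
Proof.
move=> fB fM Sp; apply: (rnorm_le_small_eq0 (c := `|M|)) => e /Sp[s /= fs ps].
have -> : f p = f (p - s) by rewrite fB fs subr0.
rewrite (le_trans (fM _))// (le_trans (ler_wpM2r (rnorm_ge0 _) (ler_norm M)))//.
by rewrite mulrC ler_wpM2r.
Qed.

(** * Orthogonal projection and the Riesz representation *)

Definition linear_subspace (S : set H) :=
  S 0 /\ forall a u v, S u -> S v -> S (a *: u + v).

(** Projection onto the closure of a subspace that need not be closed, which
    is what is needed for ranges of adjoints and for kernels.  By the
    parallelogram law a minimizing sequence for the distance from z to S is
    Cauchy; its limit is p. *)
Lemma closure_projection (S : set H) z : linear_subspace S ->
  exists2 p, adherent S p & orthocomp S (z - p).
Proof.
move=> [S0 SL].
pose D := [set rnorm (z - s) ^+ 2 | s in S].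
have D0 : D !=set0 by exists (rnorm (z - 0) ^+ 2), 0.
have lD : lbound D 0 by move=> _ [s _ <-]; exact: sqr_ge0.
have infD : has_inf D by split=> //; exists 0.
have dle s : S s -> inf D <= rnorm (z - s) ^+ 2.
  by move=> Ss; apply: ge_inf; [exists 0|exists s].
have /choice[s sP] n :
    exists s, S s /\ rnorm (z - s) ^+ 2 <= inf D + n.+1%:R^-1.
  have n0 : 0 < (n.+1%:R : R)^-1 by rewrite invr_gt0.
  have [_ [s Ss <-] sn] := inf_adherent n0 infD.
  by exists s; split => //; exact: ltW.
have Ss n : S (s n) by have [] := sP n.
have ds n : rnorm (z - s n) ^+ 2 <= inf D + n.+1%:R^-1 by have [] := sP n.
have [p pP] : exists l, forall e : R, 0 < e ->
    exists n, forall i, (n <= i)%N -> rnorm (l - s i) <= e.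
  apply: cauchy_seq_lim => e e0.
  have e40 : 0 < e ^+ 2 / 4 by rewrite divr_gt0 ?exprn_gt0.
  have [n nP] := invS_le_eventually e40; exists n => i j /nP ni /nP nj.
  rewrite -ler_sqr ?nnegrE ?rnorm_ge0 ?(ltW e0)//.
  have := parallelogram (z - s i) (z - s j).
  have -> : z - s i - (z - s j) = s j - s i by rewrite opprB addrC addrA subrK.
  have -> : z - s i + (z - s j) = 2 *: (z - (2^-1 *: s i + 2^-1 *: s j)).
    rewrite scalerBr scalerDr !scalerA divff ?pnatr_eq0// !scale1r.
    by rewrite scaler_nat mulr2n opprD addrACA.
  have mid : S (2^-1 *: s i + 2^-1 *: s j).
    by apply: (SL) => //; rewrite -[_ *: _]addr0; apply: (SL).
  rewrite rnormZ exprMn rnorm2.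
  move: (dle _ mid) (ds i) (ds j).
  rewrite (rnorm_distC (s j) (s i)); move: ni nj.
  move: i.+1%:R^-1 j.+1%:R^-1 (inf D) => di dj d; lra.
exists p.
  by move=> e /pP[n nP]; exists (s n) => //; exact: nP.
move=> u Su; apply: (rnorm_le_small_eq0 (c := 2 * rnorm u)) => e e0.
have [->|u0] := eqVneq u 0.
  by rewrite dotp0r rnorm0 /= !mulr_ge0 ?rnorm_ge0// ltW.
have up : 0 < rnorm u by rewrite rnorm_gt0.
have [n1 n1P] := pP _ e0.
have e20 : 0 < e ^+ 2 by rewrite exprn_gt0.
have [n2 n2P] := invS_le_eventually e20.
pose n := maxn n1 n2.
have ps := n1P n (leq_maxl _ _).
have en := n2P n (leq_maxr _ _).
have -> : z - p = (z - s n) - (p - s n) by rewrite opprB addrA subrK.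
rewrite dotpBl (le_trans (rnormD _ _))// rnormN.
have h1 : rnorm (dotp (p - s n) u) <= e * rnorm u.
  by rewrite (le_trans (Cauchy_Schwarz _ _))// ler_wpM2r// ltW.
suff : rnorm (dotp (z - s n) u) <= e * rnorm u by lra.
rewrite -ler_sqr ?nnegrE ?mulr_ge0 ?rnorm_ge0 ?(ltW e0)// exprMn.
rewrite -ler_pdivrMr ?exprn_gt0//.
(* z - s n is within 1 / n.+1 of the minimum, which bounds what removing its
   component along u can gain. *)
have := rnorm_sub_component (z - s n) u0.
set a := _ / dotp u u.
have : inf D <= rnorm (z - s n - a *: u) ^+ 2.
  by rewrite -addrA -opprD; apply: dle; rewrite addrC; apply: (SL).
move: (ds n) en.
by move: n.+1%:R^-1 (inf D) (rnorm (dotp _ _) ^+ 2 / _) => d i t; lra.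
Qed.

Lemma projection (S : set H) z : linear_subspace S -> closed S ->
  exists2 p, S p & orthocomp S (z - p).
Proof.
move=> sS cS; have [p Sp zp] := closure_projection z sS.
by exists p => //; apply: closed_adherent.
Qed.

(** The kernel of a nonzero f has a nonzero vector q in its orthogonal
    complement, and f is then a multiple of the product with q. *)
Lemma Riesz (f : H -> R[i]) (M : R) :
  scalar f -> (forall x, rnorm (f x) <= M * rnorm x) ->
  exists z, forall x, f x = dotp x z.
Proof.
move=> fL fM.
have f0 : f 0 = 0 by have := fL (-1) 0 0; rewrite scaler0 addr0 mulN1r addNr.
have fZ a x : f (a *: x) = a * f x by have := fL a x 0; rewrite !addr0 f0 addr0.
have fB x y : f (x - y) = f x - f y.
  by rewrite addrC -scaleN1r fL mulN1r addrC.
have [[x0 fx0]|nf] := pselect (exists x, f x != 0); last first.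
  exists 0 => x; rewrite dotp0r; apply: contrapT => fx; apply: nf; exists x.
  exact/eqP.
pose S := [set x | f x = 0].
have sS : linear_subspace S.
  by split => //= a u v fu fv; rewrite /S /= fL fu fv mulr0 addr0.
have [p Sp xp] := closure_projection x0 sS.
have fp : f p = 0 by exact: bounded_kernel_adherent fB fM Sp.
set q := x0 - p in xp.
have fq : f q = f x0 by rewrite fB fp subr0.
have qq : dotp q q != 0.
  by apply: contra_neq fx0 => /dotp_eq0 q0; rewrite -fq q0.
exists (Num.conj (f q / dotp q q) *: q) => x; rewrite dotpZr conjCK.
have : dotp q (x - (f x / f q) *: q) = 0.
  by apply: xp; rewrite /S /= fB fZ divfK ?fq// subrr.
move/(congr1 Num.conj); rewrite -dotpC conjC0 dotpBl dotpZl => /eqP.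
rewrite subr_eq0 => /eqP ->; rewrite -fq in fx0.
by field; rewrite fx0 qq.
Qed.

(** * Uniform boundedness principle *)

(** The closed balls of centre x n and radius r n are nested, so the tail of x
    stays in each of them; as the radii tend to 0, the centres converge to a
    common point. *)
Lemma nested_balls (x : nat -> H) (r : nat -> R) :
  (forall n, 0 < r n) -> (forall n, r n.+1 <= r n / 2) ->
  (forall n, rnorm (x n.+1 - x n) <= r n / 2) ->
  exists l, forall n, rnorm (l - x n) <= r n.
Proof.
move=> r0 rS xS.
have xr n k : rnorm (x (n + k)%N - x n) + r (n + k)%N <= r n.
  elim: k => [|k IH]; first by rewrite addn0 subrr rnorm0 add0r.
  rewrite addnS.
  have -> : x (n + k).+1 - x n =
      (x (n + k).+1 - x (n + k)%N) + (x (n + k)%N - x n).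
    by rewrite addrA subrK.
  have := rnormD (x (n + k).+1 - x (n + k)%N) (x (n + k)%N - x n).
  move: IH (rS (n + k)%N) (xS (n + k)%N); lra.
have rn n : r n <= r 0%N / n.+1%:R.
  elim: n => [|n IH]; first by rewrite divr1.
  apply: le_trans (rS n) _; rewrite ler_pdivrMr//.
  apply: le_trans IH _; rewrite -mulrA ler_pM2l ?r0//.
  rewrite ler_pdivlMl// ler_pdivrMr// -natrM ler_nat; lia.
have [l lP] : exists l, forall e : R, 0 < e ->
    exists n, forall i, (n <= i)%N -> rnorm (l - x i) <= e.
  apply: cauchy_seq_lim => e e0.
  have e1 : 0 < e / (2 * r 0%N) by rewrite divr_gt0// mulr_gt0.
  have [n nP] := invS_le_eventually e1; exists n => i j ni nj.
  have rne : r n <= e / 2.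
    apply: le_trans (rn n) _.
    have := nP n (leqnn n); rewrite ler_pdivlMr ?mulr_gt0//.
    by move: n.+1%:R^-1 (r 0%N) => d r0'; lra.
  move: rne (xr n (i - n)%N) (xr n (j - n)%N) (r0 i) (r0 j).
  rewrite !subnKC// (rnorm_distC (x j)).
  have -> : x i - x j = (x i - x n) + (x n - x j) by rewrite addrA subrK.
  have := rnormD (x i - x n) (x n - x j); lra.
exists l => n; apply/ler_addgt0Pr => e /lP[m mP].
have := mP (n + m)%N (leq_addl _ _).
have -> : l - x n = (l - x (n + m)%N) + (x (n + m)%N - x n).
  by rewrite addrA subrK.
have := rnormD (l - x (n + m)%N) (x (n + m)%N - x n).
move: (xr n m) (r0 (n + m)%N); lra.
Qed.

(** If W were unbounded, every ball would contain a smaller ball on which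
    some w in W satisfies n <= |<y, w>|.  Iterating over n, the common point
    of these balls would violate the pointwise bound. *)
Lemma uniform_boundedness (W : set H) :
  (forall u, exists M : R, forall w, W w -> rnorm (dotp u w) <= M) ->
  exists K : R, forall w, W w -> rnorm w <= K.
Proof.
move=> pb; apply: contrapT => nb.
have big K : exists2 w, W w & K < rnorm w.
  apply: contrapT => nw; apply: nb; exists K => w Ww; rewrite leNgt.
  by apply/negP => Kw; apply: nw; exists w.
have step (a : nat * (H * {posnum R})) : exists b : H * {posnum R},
    [/\ b.2%:num <= a.2.2%:num / 2, rnorm (b.1 - a.2.1) <= a.2.2%:num / 2 &
     exists2 w, W w & forall y, rnorm (y - b.1) <= b.2%:num ->
       a.1%:R <= rnorm (dotp y w)].
  case: a => n [x r] /=.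
  have [w Ww wr] := big ((n%:R + 1) / (r%:num / 2)).
  have w0 : 0 < rnorm w.
    by apply: le_lt_trans wr; rewrite divr_ge0// addr_ge0.
  (* Moving by h in one of the two directions changes <x, w> by |<h, w>|. *)
  pose h := (r%:num / 2 / rnorm w)%:C%C *: w.
  have nh : rnorm h = r%:num / 2.
    by rewrite rnormZ rnorm_real ?divfK ?gt_eqF// divr_ge0// ltW.
  have hw : n%:R + 1 <= rnorm (dotp h w).
    rewrite dotpZl rnormM rnorm_real ?divr_ge0 ?(ltW w0)//.
    rewrite -rnorm_sqr rnorm_real ?sqr_ge0// expr2 mulrA divfK ?gt_eqF//.
    by rewrite mulrC -ler_pdivrMr// ltW.
  have [x' xx' x'w] : exists2 x',
      rnorm (x' - x) <= r%:num / 2 & n%:R + 1 <= rnorm (dotp x' w).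
    have [xw|xw] := leP (n%:R + 1) (rnorm (dotp (x + h) w)).
      by exists (x + h) => //; rewrite addrC addKr nh.
    exists (x - h); first by rewrite addrC addKr rnormN nh.
    move: hw xw; rewrite dotpDl dotpBl.
    have : rnorm (2 * dotp h w) <=
        rnorm (dotp x w + dotp h w) + rnorm (dotp x w - dotp h w).
      have -> : 2 * dotp h w =
          (dotp x w + dotp h w) - (dotp x w - dotp h w) by ring.
      by rewrite (le_trans (rnormD _ _))// rnormN.
    by rewrite rnormM rnorm2; lra.
  (* On a ball of radius 1 / |w| around x', <y, w> varies by at most 1. *)
  have r'0 : 0 < Num.min (r%:num / 2) (rnorm w)^-1.
    by rewrite lt_min invr_gt0 w0 divr_gt0.
  exists (x', PosNum r'0); split => //=; first by rewrite ge_min lexx.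
  exists w => // y; rewrite le_min => /andP[_ yx].
  have : rnorm (dotp (x' - y) w) <= 1.
    by rewrite (le_trans (Cauchy_Schwarz _ _))// -ler_pdivlMr// mul1r
      rnorm_distC.
  have := rnormD (dotp (x' - y) w) (dotp y w).
  by rewrite -dotpDl subrK; lra.
have [g gP] := choice step.
pose fix a n := if n is m.+1 then g (m, a m) else (0 : H, PosNum (@ltr01 R)).
have [|||l lP] := @nested_balls (fun n => (a n).1) (fun n => (a n).2%:num).
- by [].
- by move=> n; have [] := gP (n, a n).
- by move=> n; have [] := gP (n, a n).
have [M MP] := pb l.
pose n := (Num.truncn M).+1.
have [_ _ [w Ww wP]] := gP (n, a n).
have := le_trans (wP l (lP n.+1)) (MP w Ww).
by rewrite leNgt truncnS_gt.
Qed.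

(** * Orthogonal complements *)

Lemma orthocomp_self S x : S x -> orthocomp S x -> x = 0.
Proof. by move=> Sx /(_ x Sx); apply: dotp_eq0. Qed.

Lemma orthocomp_subspace S : linear_subspace (orthocomp S).
Proof.
split; first by move=> y _; rewrite dotp0l.
move=> a u v Su Sv y Sy.
by rewrite dotpDl dotpZl Su// Sv// mulr0 addr0.
Qed.

Lemma orthocomp_adherent S p : adherent (orthocomp S) p -> orthocomp S p.
Proof.
move=> Sp y Sy.
apply: (bounded_kernel_adherent (f := fun x => dotp x y) (M := rnorm y))
  => [u v|u|e /Sp[s Ss ps]].
- by rewrite dotpBl.
- by rewrite mulrC Cauchy_Schwarz.
- by exists s => //=; apply: Ss.
Qed.

Lemma range_linear_subspace (A : {linear H -> H}) : linear_subspace (range A).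
Proof.
split; first by exists 0; rewrite ?linear0.
by move=> a _ _ [u _ <-] [v _ <-]; exists (a *: u + v); rewrite ?linearP.
Qed.

Lemma nullspace_subspace (A : {linear H -> H}) : linear_subspace (nullspace A).
Proof.
split=> [|a u v /= Au Av]; first by rewrite /nullspace /= linear0.
by rewrite /nullspace/= linearP Au Av scaler0 addr0.
Qed.

(** * Adjoint pairs *)

(** Linearity of T and of T', and the uniqueness of T' given T, follow from
    this relation alone, and it is symmetric, so that T and T' can be
    exchanged freely. *)
Definition adjoint_pair T T' := forall x y, dotp (T x) y = dotp x (T' y).

Lemma adjoint_pair_sym T T' : adjoint_pair T T' -> adjoint_pair T' T.
Proof. by move=> TT x y; rewrite dotpC -TT -dotpC. Qed.

Lemma adjoint_pair_linear T T' : adjoint_pair T T' -> linear T.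
Proof.
move=> TT a u v; apply: dotp_injr => x; rewrite -(adjoint_pair_sym TT).
by rewrite !dotpDr !dotpZr !(adjoint_pair_sym TT).
Qed.

Lemma adjoint_pairB T T' : adjoint_pair T T' -> {morph T : u v / u - v}.
Proof.
move=> /adjoint_pair_linear TL u v.
by rewrite addrC -scaleN1r TL scaleN1r addrC.
Qed.

Lemma adjoint_pair0 T T' : adjoint_pair T T' -> T 0 = 0.
Proof. by move=> /adjoint_pairB TB; rewrite -[in LHS](subrr 0) TB subrr. Qed.

Lemma adjoint_pairE T T' : adjoint_pair T T' -> adjoint T = T'.
Proof.
move=> TT; apply/funext => y; apply: dotp_injr => x; rewrite -TT.
apply/esym; rewrite /adjoint; move: x.
apply: (@xgetPex _ _ [set z | forall x, dotp (T x) y = dotp x z]).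
by exists (T' y).
Qed.

Lemma bounded_adjoint_pair T (M : R) :
  linear T -> (forall x, rnorm (T x) <= M * rnorm x) ->
  adjoint_pair T (adjoint T).
Proof.
move=> TL TM x y; move: x.
apply: (@xgetPex _ _ [set z | forall x, dotp (T x) y = dotp x z]).
apply: (@Riesz (fun x => dotp (T x) y) (M * rnorm y)).
  by move=> a u v; rewrite TL dotpDl dotpZl.
move=> x; rewrite (le_trans (Cauchy_Schwarz _ _))// mulrAC.
by rewrite ler_wpM2r ?rnorm_ge0.
Qed.

(** The orthogonal complement of R(T* ) is N(T), so the residual of projecting
    x onto the closure of R(T* ) lies in N(T) as well as in its complement. *)
Lemma range_adjoint_dense T T' x : adjoint_pair T T' ->
  orthocomp (nullspace T) x -> adherent (range T') x.
Proof.
move=> TT Nx.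
have sT : linear_subspace (range T').
  have TL := adjoint_pair_linear (adjoint_pair_sym TT).
  split; first by exists 0 => //; rewrite (adjoint_pair0 (adjoint_pair_sym TT)).
  by move=> a _ _ [u _ <-] [v _ <-]; exists (a *: u + v) => //; rewrite TL.
have [p Tp xp] := closure_projection x sT.
suff : x - p = 0 by move/eqP; rewrite subr_eq0 => /eqP->.
apply: (@orthocomp_self (nullspace T)).
  apply: dotp_injr => w; rewrite dotp0r; apply/dotp_sym0.
  by rewrite TT xp//; exists w.
have Np : orthocomp (nullspace T) p.
  apply: orthocomp_adherent => e /Tp[s [w _ ws] ps]; exists s => //.
  by move=> n Nn; rewrite -ws (adjoint_pair_sym TT) Nn dotp0r.
by move=> n Nn; rewrite dotpBl Nx// Np// subrr.
Qed.

(** * Pointwise description of the Moore-Penrose inverse *)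

(** Describes the value x of the Moore-Penrose inverse of A at y without
    choice operators: x is the solution of least norm of A x = u, where u is
    the component of y in R(A). *)
Definition is_mpinv_at A y x :=
  orthocomp (nullspace A) x /\ orthocomp (range A) (y - A x).

Lemma is_mpinv_at_uniq (A : {linear H -> H}) y x x' :
  is_mpinv_at A y x -> is_mpinv_at A y x' -> x = x'.
Proof.
move=> [nx rx] [nx' rx']; apply/eqP; rewrite -subr_eq0; apply/eqP.
apply: (@orthocomp_self (nullspace A)); last first.
  by move=> n Nn; rewrite dotpBl nx// nx'// subrr.
rewrite /nullspace /=; apply: (@orthocomp_self (range A)).
  by exists (x - x').
move=> u Au; rewrite linearB/=.
have -> : A x - A x' = (y - A x') - (y - A x).
  by rewrite opprB [RHS]addrC addrA subrK.
by rewrite dotpBl rx// rx'// subrr.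
Qed.

(** The component of y in R(A) is A x0 for some x0; subtracting from x0 its
    projection onto N(A), which is closed as A is bounded, gives the preimage
    in N(A)^perp. *)
Lemma mpinvP (A : {linear H -> H}) (M : R) y :
  (forall x, rnorm (A x) <= M * rnorm x) -> mpinv_dom A y ->
  is_mpinv_at A y (mpinv A y).
Proof.
move=> AM [u0 Au0 yu0]; rewrite /mpinv.
set u := xget _ _.
have [[x0 _ xu] yu] : range A u /\ orthocomp (range A) (y - u).
  apply: (@xgetPex _ _ [set u | range A u /\ orthocomp (range A) (y - u)]).
  by exists u0.
have [q Nq xq] := closure_projection x0 (nullspace_subspace A).
have Aq : A q = 0.
  by apply: (bounded_kernel_adherent _ AM) => // a b; rewrite linearB.
have [rx Ax] : orthocomp (nullspace A) (restr_inv A u) /\ A (restr_inv A u) = u.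
  apply: (@xgetPex _ _ [set x | orthocomp (nullspace A) x /\ A x = u]).
  by exists (x0 - q); split => //; rewrite linearB Aq subr0 xu.
by split => //; rewrite Ax.
Qed.

(** Every x in N(A)^perp is the image of A x under the inverse. *)
Lemma mpinv_rangeE (A : {linear H -> H}) (M : R) :
  (forall x, rnorm (A x) <= M * rnorm x) ->
  mpinv_range A = orthocomp (nullspace A).
Proof.
move=> AM; apply/seteqP; split=> [_ [y yd <-]|x Nx].
  by have [] := mpinvP AM yd.
have Axx : is_mpinv_at A (A x) x.
  by split => // v _; rewrite subrr dotp0l.
have yd : mpinv_dom A (A x) by exists (A x) => // v _; rewrite subrr dotp0l.
by exists (A x) => //; apply: is_mpinv_at_uniq (mpinvP AM yd) Axx.
Qed.

(** * Penrose equations *)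

(** C is the Moore-Penrose inverse of A.  Including the adjoints makes the
    notion invariant under exchange of (A, A') with (C, C'). *)
Record penrose A A' C C' : Prop := Penrose {
  penrose_adj : adjoint_pair A A';
  penrose_adj_inv : adjoint_pair C C';
  penroseAK : forall x, A (C (A x)) = A x;
  penroseKA : forall x, C (A (C x)) = C x;
  penrose_rproj : adjoint_pair (A \o C) (A \o C);
  penrose_lproj : adjoint_pair (C \o A) (C \o A) }.

Lemma penrose_sym A A' C C' : penrose A A' C C' -> penrose C C' A A'.
Proof. by case=> *; constructor. Qed.

(** A* = (ACA)* = (CA)*A* = CAA*, and C = CAC = (CA)*C = A*C*C. *)
Lemma penrose_range_adjoint A A' C C' : penrose A A' C C' -> range A' = range C.
Proof.
case=> AA CC AK KA projR projL; apply/seteqP; split=> _ [x _ <-].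
  exists (A (A' x)) => //; apply: dotp_injr => z.
  by rewrite -[LHS]projL/= -!AA AK.
exists (C' (C x)) => //; apply: dotp_injr => z.
rewrite -AA -CC.
by rewrite [LHS]projL /= KA.
Qed.

(** * Moore-Penrose inverse of an operator with closed range *)

Section Closed_range.
Context (A : {linear H -> H}) (M : R).
Context (AM : forall x, rnorm (A x) <= M * rnorm x).
Context (cA : closed (range A)).

Lemma closed_range_mpinvP y : is_mpinv_at A y (mpinv A y).
Proof.
apply: (mpinvP AM).
by have [u Au yu] := projection y (range_linear_subspace A) cA; exists u.
Qed.

Lemma mpinv_linear : linear (mpinv A).
Proof.
move=> a u v.
have [nu ru] := closed_range_mpinvP u; have [nv rv] := closed_range_mpinvP v.
apply: (is_mpinv_at_uniq (closed_range_mpinvP _)); split.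
  by apply: (orthocomp_subspace _).2.
rewrite linearP opprD addrACA -scalerBr.
by apply: (orthocomp_subspace _).2.
Qed.

(** The part of y outside R(A) is orthogonal to R(A). *)
Lemma mpinv_residual y w : dotp y (A w) = dotp (A (mpinv A y)) (A w).
Proof.
have [_ r] := closed_range_mpinvP y.
by apply/eqP; rewrite -subr_eq0 -dotpBl r//; exists w.
Qed.

(** This is where closedness of R(A) enters essentially: it makes the inverse
    defined everywhere, so that the set W is weakly bounded. *)
Lemma mpinv_bounded : exists N : R, forall u, rnorm (mpinv A u) <= N * rnorm u.
Proof.
have AA := bounded_adjoint_pair (linearP A) AM.
have A'A := adjoint_pair_sym AA.
pose W := [set w | range A w /\ rnorm (adjoint A w) <= 1].
have [K WK] : exists K : R, forall w, W w -> rnorm w <= K.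
  apply: uniform_boundedness => u; exists (rnorm (mpinv A u)).
  move=> _ [[w _ <-] A'w]; rewrite mpinv_residual AA.
  by rewrite (le_trans (Cauchy_Schwarz _ _))// ler_piMr// rnorm_ge0.
exists (4 * K) => u; set x := mpinv A u.
have K0 : 0 <= K.
  apply: le_trans (rnorm_ge0 0) (WK 0 _).
  split; first by have [] := range_linear_subspace A.
  by rewrite (adjoint_pair0 A'A) rnorm0.
have [x0|x0] := eqVneq x 0.
  by rewrite x0 rnorm0 !mulr_ge0// rnorm_ge0.
have xp : 0 < rnorm x by rewrite rnorm_gt0.
have [nx _] := closed_range_mpinvP u.
(* Accuracy |x| / 2 suffices for <x, A*w> to retain half of <x, x>. *)
have x20 : 0 < rnorm x / 2 by rewrite divr_gt0.
have [_ [w0 _ <-] xw0] := range_adjoint_dense AA nx x20.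
(* The approximant A*w0 does not change when w0 is projected onto R(A). *)
pose v := mpinv A w0; pose w := A v.
have A'w : adjoint A w0 = adjoint A w.
  by apply: dotp_injr => z; rewrite -!AA dotpC mpinv_residual -dotpC.
rewrite A'w -/x in xw0.
have nw : rnorm (adjoint A w) <= 2 * rnorm x.
  have -> : adjoint A w = x - (x - adjoint A w) by rewrite opprB addrC subrK.
  by have := rnormD x (- (x - adjoint A w)); rewrite rnormN; lra.
have wK : rnorm w <= K * (2 * rnorm x).
  rewrite -ler_pdivrMr ?mulr_gt0// mulrC.
  have i0 : 0 <= (2 * rnorm x)^-1 by rewrite invr_ge0 mulr_ge0// ltW.
  rewrite -[X in X * _](rnorm_real i0) -rnormZ; apply: WK; split.
    by exists ((2 * rnorm x)^-1%:C%C *: v) => //; rewrite linearZ.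
  have -> (a : R[i]) : adjoint A (a *: w) = a *: adjoint A w.
    by apply: dotp_injr => z; rewrite -AA !dotpZr AA.
  by rewrite rnormZ rnorm_real// ler_pdivrMl ?mulr_gt0// mulr1.
have xx : rnorm x ^+ 2 <= rnorm x * (rnorm x / 2) + rnorm u * rnorm w.
  rewrite -[leLHS]rnorm_real ?sqr_ge0// rnorm_sqr.
  have -> : dotp x x = dotp x (x - adjoint A w) + dotp u w.
    by rewrite dotpBr -AA /w (mpinv_residual u v) subrK.
  rewrite (le_trans (rnormD _ _))// lerD// (le_trans (Cauchy_Schwarz _ _))//.
  by rewrite ler_wpM2l ?rnorm_ge0.
have uw : rnorm u * rnorm w <= rnorm u * (K * (2 * rnorm x)).
  by rewrite ler_wpM2l ?rnorm_ge0.
rewrite -(ler_pM2r xp); move: xx uw.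
move: (rnorm u) (rnorm w) (rnorm x) => a b c; lra.
Qed.

(** ACA = A as Ax - ACAx lies both in R(A) and in its complement; CAC = C by
    uniqueness of the value of C at ACy; AC and CA are the orthogonal
    projections onto R(A) and N(A)^perp. *)
Lemma mpinv_penrose : penrose A (adjoint A) (mpinv A) (adjoint (mpinv A)).
Proof.
have [N CN] := mpinv_bounded.
have AK x : A (mpinv A (A x)) = A x.
  apply/esym/eqP; rewrite -subr_eq0; apply/eqP.
  apply: (@orthocomp_self (range A)).
    by exists (x - mpinv A (A x)); rewrite ?linearB.
  by have [] := closed_range_mpinvP (A x).
constructor => //.
- exact: bounded_adjoint_pair (linearP A) AM.
- exact: bounded_adjoint_pair mpinv_linear CN.
- move=> y; apply: (is_mpinv_at_uniq (closed_range_mpinvP _)).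
  by split=> [|v _]; [have [] := closed_range_mpinvP y | rewrite subrr dotp0l].
- by move=> x y /=; rewrite mpinv_residual dotpC mpinv_residual -dotpC.
- have lproj x y :
      dotp (mpinv A (A x)) y = dotp (mpinv A (A x)) (mpinv A (A y)).
    apply/eqP; rewrite -subr_eq0 -dotpBr; apply/eqP.
    have [nx _] := closed_range_mpinvP (A x); apply: nx.
    by rewrite /nullspace /= linearB AK subrr.
  by move=> x y /=; rewrite lproj [RHS]dotpC (lproj y x) -dotpC.
Qed.

End Closed_range.

(** * Diamond order *)

(** From AA*A = AB*A one gets A* = CAA*AC = CAB*AC, that is A = ACBCA, whence
    C = CAC = CBC.  Conversely, R(A* ) = R(C) and CBC = C allow replacing B by A
    in <BA*z, Ax> = <A*z, B*Ax>. *)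
Lemma diamond_penrose A A' C C' B B' D D' :
  penrose A A' C C' -> penrose B B' D D' ->
  diamond_le A B <->
  [/\ range A `<=` range B, range C `<=` range D & forall x, C (B (C x)) = C x].
Proof.
move=> pA pB; rewrite /diamond_le.
rewrite (adjoint_pairE (penrose_adj pA)) (adjoint_pairE (penrose_adj pB)).
rewrite (penrose_range_adjoint pA) (penrose_range_adjoint pB).
case: (pA) pB => AA CC AK KA projR projL [BB _ _ _ _ _].
split=> -[rAB rCD e]; split=> // x.
  have ABA z : A (C (B (C (A z)))) = A z.
    apply: dotp_injl => w; rewrite [RHS]AA.
    have -> : A' w = C (A (B' (A (C w)))).
      rewrite -[A (B' _)]e /=; apply: dotp_injr => v.
      by rewrite -[RHS]projL /= -!AA AK -[RHS]projR /= AK.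
    by rewrite -[RHS]projL /= -[RHS]BB -[RHS]projR.
  by have := congr1 C (ABA (C x)); rewrite !KA.
apply: dotp_injr => z; rewrite /= -!(adjoint_pair_sym AA).
have [c _ <-] : range C (A' z).
  by rewrite -(penrose_range_adjoint pA); exists z.
by rewrite -(AA (C c)) -(BB (C c)) -[in RHS](AK x) -[RHS]projR /= e.
Qed.

(** Both directions show that R(C) and R(D - C) meet only in 0; the
    hypothesis identifies the latter with N(B - A)^perp. *)
Lemma inner_inverse_transfer A A' B B' C C' D D' :
  penrose A A' C C' -> penrose B B' D D' ->
  range A `<=` range B -> range C `<=` range D ->
  orthocomp (nullspace (B \- A)) = range (D \- C) ->
  (forall x, C (B (C x)) = C x) <-> (forall x, A (D (A x)) = A x).
Proof.
move=> pA pB rAB rCD hE.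
have BDA x : B (D (A x)) = A x.
  have [b _ <-] : range B (A x) by apply: rAB; exists x.
  by rewrite (penroseAK pB).
have DBC x : D (B (C x)) = C x.
  have [d _ <-] : range D (C x) by apply: rCD; exists x.
  by rewrite (penroseKA pB).
have range_adj w : exists c, A' w = C c.
  have [c _ <-] : range C (A' w).
    by rewrite -(penrose_range_adjoint pA); exists w.
  by exists c.
case: (pA) => AA CC AK KA projR projL; case: (pB) => BB DD _ _ projRB projLB.
have CB := adjoint_pairB CC.
have A'B := adjoint_pairB (adjoint_pair_sym AA).
have BB' := adjoint_pairB BB.
split=> [CBC | ADA].
  have CBD y : C (B (D y)) = C y.
    apply: dotp_injr => z; rewrite -!(adjoint_pair_sym CC).
    have [a _ <-] : range A (C' z).
      by rewrite -(penrose_range_adjoint (penrose_sym pA)); exists z.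
    by rewrite -[LHS]projRB /= BDA.
  have A'DA' w : A' (D' (A' w)) = A' w.
    pose u := D' (A' w).
    have B'u : B' u = A' w.
      have [c A'c] := range_adj w; rewrite /u A'c; apply: dotp_injr => z.
      by rewrite -BB -DD [LHS]projLB /= DBC.
    have [c yc] := range_adj (w - u).
    have : orthocomp (nullspace (B \- A)) (A' (w - u)).
      move=> n /eqP; rewrite /= subr_eq0 => /eqP BAn.
      by apply: dotp_sym0; rewrite A'B dotpBr -B'u -BB BAn AA subrr.
    rewrite hE => -[f _ /= Ff].
    (* CB vanishes on R(D - C) and is the identity on R(C). *)
    have : C (B (A' (w - u))) = 0.
      by rewrite -Ff BB' CB CBD CBC subrr.
    rewrite yc CBC -yc A'B => /eqP; rewrite subr_eq0 => /eqP/esym.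
    exact.
  move=> x; apply: dotp_injl => w.
  by rewrite AA DD AA A'DA' -AA.
move=> x; pose u := B (C x).
have Fu : D u - C u = C (x - u) by rewrite /u DBC CB.
have yN : orthocomp (nullspace (B \- A)) (C (x - u)) by rewrite hE; exists u.
apply/esym/eqP; rewrite -subr_eq0 -CB; apply/eqP.
have [w _ yw] : range A' (C (x - u)).
  by rewrite (penrose_range_adjoint pA); exists (x - u).
apply: dotp_injr => z; rewrite dotp0r -yw -AA -ADA AA yw.
(* D (A z) lies in N(B - A). *)
apply/dotp_sym0/yN; rewrite /nullspace /=.
by rewrite BDA ADA subrr.
Qed.

End Hilbert_operators.

Theorem corollary4p11 (R : realType) (H : hilbertType R)
    (A B : {linear H -> H})
    (A_bounded : bounded_near A (nbhs (0 : H)))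
    (B_bounded : bounded_near B (nbhs (0 : H)))
    (A_closed_range : closed (range A))
    (B_closed_range : closed (range B))
    (range_mpinv_sub :
       mpinv_range (B \- A) = range (mpinv B \- mpinv A))
    (range_mpinv_adjoint_sub :
       mpinv_range (adjoint B \- adjoint A) =
       range (mpinv (adjoint B) \- mpinv (adjoint A))) :
  diamond_le A B <-> diamond_le (mpinv A) (mpinv B).
Proof.
have [MA AM] := bounded_near_rnorm A_bounded.
have [MB BM] := bounded_near_rnorm B_bounded.
have pA := mpinv_penrose AM A_closed_range.
have pB := mpinv_penrose BM B_closed_range.
have BAM x : rnorm ((B \- A) x) <= (MB + MA) * rnorm x.
  by rewrite /= (le_trans (rnormD _ _))// rnormN mulrDl lerD.
have hE : orthocomp (nullspace (B \- A)) = range (mpinv B \- mpinv A).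
  by rewrite -range_mpinv_sub (mpinv_rangeE BAM).
have transfer rAB rCD := inner_inverse_transfer pA pB rAB rCD hE.
split.
  move/(diamond_penrose pA pB) => [rAB rCD CBC].
  apply/(diamond_penrose (penrose_sym pA) (penrose_sym pB)).
  by split => //; apply/transfer.
move/(diamond_penrose (penrose_sym pA) (penrose_sym pB)) => [rCD rAB ADA].
apply/(diamond_penrose pA pB).
by split => //; apply/transfer.
Qed.
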